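(* Let $D$ be an integral domain. The following statements are equivalent: (1) $D$ is a VFD. (2) For each star operation $*$ of finite type on $D$, ${\rm Cl}_*(D)=\{0\}$ and every $*$-invertible $*$-ideal of $D$ is a finite $*$-product of valuation ideals of $D$. (3) For each star operation $*$ of finite type on $D$, $D$ is a $*$-VIFD and ${\rm Cl}_*(D)=\{0\}$. (4) There exists a star operation $*$ of finite type on $D$ such that ${\rm Cl}_*(D)=\{0\}$ and every $*$-invertible $*$-ideal of $D$ is a finite $*$-product of valuation ideals of $D$. (5) There exists a star operation $*$ of finite type on $D$ such that $D$ is a $*$-VIFD and ${\rm Cl}_*(D)=\{0\}$.
   Context: Let $D$ be an integral domain with quotient field $K$. An overring of $D$ is a subring of $K$ containing $D$. $F(D)$ (resp. $f(D)$) is the set of nonzero fractional (resp. nonzero finitely generated fractional) ideals of $D$; for $A\in F(D)$, $A^{-1}=\{x\in K\mid xA\subseteq D\}$. A star operation on $D$ is a map $*:F(D)\to F(D)$, $A\mapsto A_*$, such that for all $A,B\in F(D)$ and nonzero $c\in K$: $A\subseteq A_*=(A_* )_*$; $A\subseteq B$ implies $A_*\subseteq B_*$; $(cA)_*=cA_*$; $D_*=D$. It is of finite type if $A_*=\bigcup_{C\in f(D),\,C\subseteq A}C_*$ for all $A\in F(D)$. A fractional $*$-ideal is an $I\in F(D)$ with $I_*=I$; a $*$-ideal is a fractional $*$-ideal contained in $D$. $I\in F(D)$ is $*$-invertible if $(II^{-1})_*=D$. The $*$-invertible fractional $*$-ideals form an abelian group $T_*(D)$ under $(I,J)\mapsto(IJ)_*$,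 and ${\rm Cl}_*(D)$ is the quotient of $T_*(D)$ by the subgroup of nonzero principal fractional ideals. A finite $*$-product of ideals $I_1,\dots,I_n$ is $(\prod_{i=1}^n I_i)_*$. An ideal $I$ of $D$ is a valuation ideal if there is a valuation overring $V$ of $D$ with $IV\cap D=I$ ($D$ itself is allowed). A valuation element of $D$ is a nonzero nonunit $a\in D$ such that $aD$ is a valuation ideal. $D$ is a VFD (valuation factorization domain) if every nonzero nonunit of $D$ is a finite product of valuation elements. $D$ is a $*$-VIFD ($*$-valuation ideal factorization domain) if each nonzero principal ideal $I$ of $D$ can be written as $I=(\prod_{i=1}^n I_i)_*$ with $n\in\mathbb{N}$ and valuation ideals $I_i$ of $D$. *)

(* Defs.v *)
From mathcomp Require Import all_boot all_order all_algebra.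
From mathcomp Require Import boolp classical_sets.

Set Implicit Arguments.
Unset Strict Implicit.
Unset Printing Implicit Defensive.

Import GRing.Theory.
Local Open Scope ring_scope.
Local Open Scope classical_set_scope.

(* D is identified with its image in K = {fraction D}; all ideals of D are
   regarded as subsets of K. *)

Section Ideals.
Variable D : idomainType.
Implicit Types A B I V : set {fraction D}.

Definition ring_image : set {fraction D} := range (@tofrac D).

Definition is_submodule A : Prop :=
  [/\ A 0, forall x y, A x -> A y -> A (x + y)
    & forall (d : D) x, A x -> A (tofrac d * x)].

Definition principal (c : {fraction D}) : set {fraction D} :=
  [set c * x | x in ring_image].

Definition scale_set (c : {fraction D}) A : set {fraction D} :=
  [set c * x | x in A].

Definition prod_set A B : set {fraction D} :=
  [set x | exists n (a b : 'I_n -> {fraction D}),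
     [/\ forall i, A (a i), forall i, B (b i) & x = \sum_(i < n) a i * b i]].

Definition inv_set A : set {fraction D} :=
  [set x | scale_set x A `<=` ring_image].

(* F(D) *)
Definition frac_ideal A : Prop :=
  [/\ is_submodule A,
      exists2 d : D, d != 0 & scale_set (tofrac d) A `<=` ring_image
    & exists2 x : {fraction D}, x != 0 & A x].

(* f(D) *)
Definition fg_frac_ideal A : Prop :=
  frac_ideal A /\
  exists n (g : 'I_n -> {fraction D}),
    A = [set x | exists d : 'I_n -> D, x = \sum_(i < n) tofrac (d i) * g i].

Definition is_ideal I : Prop := is_submodule I /\ I `<=` ring_image.

Definition overring V : Prop :=
  ring_image `<=` V /\ subring_closed (mem V).

Definition valuation_overring V : Prop :=
  overring V /\ forall x : {fraction D}, x != 0 -> V x \/ V x^-1.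

Definition valuation_ideal I : Prop :=
  is_ideal I /\
  exists2 V, valuation_overring V & prod_set I V `&` ring_image = I.

Definition valuation_element (a : D) : Prop :=
  [/\ a != 0, a \isn't a GRing.unit & valuation_ideal (principal (tofrac a))].

Definition VFD : Prop :=
  forall x : D, x != 0 -> x \isn't a GRing.unit ->
  exists n (a : 'I_n.+1 -> D),
    (forall i, valuation_element (a i)) /\ x = \prod_(i < n.+1) a i.

(* Only the values of star_fun on F(D) are meaningful; every use below is
   on an element of F(D). *)
Record star_operation := StarOperation {
  star_fun :> set {fraction D} -> set {fraction D};
  star_frac : forall A, frac_ideal A -> frac_ideal (star_fun A);
  star_ext : forall A, frac_ideal A -> A `<=` star_fun A;
  star_idem : forall A, frac_ideal A -> star_fun (star_fun A) = star_fun A;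
  star_mono : forall A B, frac_ideal A -> frac_ideal B ->
    A `<=` B -> star_fun A `<=` star_fun B;
  star_scale : forall (c : {fraction D}) A, c != 0 -> frac_ideal A ->
    star_fun (scale_set c A) = scale_set c (star_fun A);
  star_ring : star_fun ring_image = ring_image
}.

Implicit Type star : star_operation.

Definition finite_type star : Prop :=
  forall A, frac_ideal A ->
  star A = \bigcup_(C in [set C | fg_frac_ideal C /\ C `<=` A]) star C.

Definition frac_star_ideal star I : Prop := frac_ideal I /\ star I = I.

Definition star_ideal star I : Prop :=
  frac_star_ideal star I /\ I `<=` ring_image.

Definition star_invertible star I : Prop :=
  frac_ideal I /\ star (prod_set I (inv_set I)) = ring_image.

(* The underlying set of T_*(D), whose group law is (I, J) |-> (IJ)_*. *)
Definition star_T star : set (set {fraction D}) :=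
  [set I | frac_star_ideal star I /\ star_invertible star I].

(* The subgroup of nonzero principal fractional ideals. *)
Definition principal_frac : set (set {fraction D}) :=
  [set principal c | c in [set c : {fraction D} | c != 0]].

(* The coset of I in T_*(D) modulo principal_frac. *)
Definition star_class star I : set (set {fraction D}) :=
  [set star (prod_set I P) | P in principal_frac].

Definition star_Cl star : set (set (set {fraction D})) :=
  [set star_class star I | I in star_T star].

(* The identity of T_*(D) is D, so the zero of Cl_*(D) is the class of D. *)
Definition star_Cl_trivial star : Prop :=
  star_Cl star = [set star_class star ring_image].

(* Valuation ideals may be zero, but star applies only to nonzero fractional
   ideals, hence the explicit frac_ideal condition on the product. *)
Definition star_product_of_valuation_ideals star I : Prop :=
  exists n (J : 'I_n.+1 -> set {fraction D}),
    let P := \big[prod_set/ring_image]_(i < n.+1) J i in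
    [/\ forall i, valuation_ideal (J i), frac_ideal P & I = star P].

Definition star_VIFD star : Prop :=
  forall a : D, a != 0 ->
  star_product_of_valuation_ideals star (principal (tofrac a)).

Definition star_invertible_factorization star : Prop :=
  forall I, star_ideal star I -> star_invertible star I ->
  star_product_of_valuation_ideals star I.

End Ideals.

(* Main.v *)
Require Import Defs.
From mathcomp Require Import all_boot all_order all_algebra.
From mathcomp Require Import boolp classical_sets.
From mathcomp Require Import ring.

(** Call [a != 0] contracted if [a V `&` D = a D] for some valuation overring
    [V]: the contracted elements are the units and the valuation elements, and
    [D] is a VFD when every nonzero element is a product of contracted ones.
    Condition (1) is compared with the four others through two facts.

    In a VFD, star-invertible star-ideals of finite type star operations are
    principal ([star_invertible_principal]).  Let [v] be contracted from [V].
    Comparing values in [V] shows that the radical of [v D] is prime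
    ([in_radical_prime]), and that every divisor of a power of [v] is
    comparable to [v] for divisibility ([divides_power_comparable]).  So if [v]
    divides a product of contracted elements, then [v] is comparable to one of
    them, and cancelling that factor shows inductively that [v] is primal.
    Primality passes to finite families and then to products of contracted
    elements, hence to all of [D] in a VFD: if [d] divides all [a_i b_j], then
    [d = d1 d2] with [d1] dividing the [a_i] and [d2] the [b_j].  Since
    star-invertibility of [I] is witnessed by finitely many [a_i] in [I] and
    [b_j] in [I^-1], such a splitting exhibits a generator of [I].

    Conversely let the class group be trivial and let [c D] be the star closure
    of a product of valuation ideals.  Each factor [J] is star-invertible, so
    its closure is some [b D] ([star_factor_principal]).  The ideal [J] itself
    need not be star-closed; still [J = J V `&` D] forces
    [b V `&` D = b D] ([contracted_of_star]), and [c] is a product of such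
    elements [b].

    The remaining implications are formal: when the class group is trivial, the
    star-invertible star-ideals are the nonzero principal integral ideals, and
    the identity is a star operation of finite type. *)

(** * Two identities in a field *)

Section FieldIdentities.
Import GRing.Theory.
Local Open Scope ring_scope.
Variable F : fieldType.
Implicit Types a b c v w : F.

Fact square_split a b v : b != 0 -> v != 0 ->
  a ^+ 2 / v = a / b * (a * b / v).
Proof. by move=> b0 v0; field; rewrite b0 v0. Qed.

Fact power_split v w c n : v != 0 -> w != 0 -> w * c = v ^+ n.+2 ->
  c / v = v ^+ n * (v / w).
Proof.
move=> v0 w0 Ec; have -> : c = v ^+ n.+2 / w by rewrite -Ec mulrC mulKf.
by rewrite !exprS; field; rewrite v0 w0.
Qed.

End FieldIdentities.

(** * Primality of valuation elements *)

Section Divisibility.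
Set Implicit Arguments.
Unset Strict Implicit.
Unset Printing Implicit Defensive.
Import GRing.Theory.
Local Open Scope ring_scope.
Local Open Scope classical_set_scope.
Variable D : idomainType.
Implicit Types (a b c v w x y : D) (s t : seq D) (V : set {fraction D}).

Definition divides a b : Prop := exists c, b = a * c.

Lemma divides_refl a : divides a a.
Proof. by exists 1; rewrite mulr1. Qed.

Lemma divides1l a : divides 1 a.
Proof. by exists a; rewrite mul1r. Qed.

Lemma divides_trans a b c : divides a b -> divides b c -> divides a c.
Proof. by move=> [x ->] [y ->]; exists (x * y); rewrite mulrA. Qed.

Lemma divides_mull a b c : divides a b -> divides a (b * c).
Proof. by move=> [x ->]; exists (x * c); rewrite mulrA. Qed.

Lemma divides_mem a s : a \in s -> divides a (\prod_(x <- s) x).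
Proof. by move=> sa; rewrite (big_rem a) //=; exact/divides_mull/divides_refl. Qed.

Lemma divides_factor a b c : a != 0 -> divides (a * b) (a * c) -> divides b c.
Proof. by move=> a0 [d]; rewrite -mulrA => /(mulfI a0) ->; exists d. Qed.

Lemma dividesP a b : a != 0 ->
  divides a b <-> ring_image (tofrac b / tofrac a).
Proof.
move=> a0; have Fa0 : tofrac a != 0 by rewrite tofrac_eq0.
split=> [[c ->]|[c _ /(congr1 ( *%R^~ (tofrac a)))]].
  by exists c => //; rewrite tofracM mulrAC divff ?mul1r.
rewrite mulfVK // -tofracM => /eqP; rewrite tofrac_eq => /eqP <-.
by exists c; rewrite mulrC.
Qed.

Lemma valuation_overring_incl V x : valuation_overring V -> V (tofrac x).
Proof. by move=> [[subV _] _]; apply: subV; exists x. Qed.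

Lemma valuation_overringM V (x y : {fraction D}) :
  valuation_overring V -> V x -> V y -> V (x * y).
Proof.
move=> [[_ [_ _ VM]] _] Vx Vy.
by have /set_mem := VM x y (mem_set Vx) (mem_set Vy).
Qed.

Lemma valuation_overringD V (x y : {fraction D}) :
  valuation_overring V -> V x -> V y -> V (x + y).
Proof.
move=> [[subV [_ VB _]] _] Vx Vy.
have V0 : V 0 by apply: subV; exists 0; rewrite ?tofrac0.
have /set_mem VN := VB 0 y (mem_set V0) (mem_set Vy).
by have /set_mem := VB x _ (mem_set Vx) (mem_set VN); rewrite sub0r opprK.
Qed.

Lemma valuation_overring1 V : valuation_overring V -> V 1.
Proof. by move=> valV; rewrite -tofrac1; exact: valuation_overring_incl. Qed.

(** Equivalently, [v V `&` D = v D] with [v] nonzero.  Units are allowed, which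
    makes the class of elements contracted from [V] closed under divisors. *)
Definition contracted V v : Prop :=
  v != 0 /\ forall x, V (tofrac x / tofrac v) -> divides v x.

Definition contracted_valuation v : Prop :=
  exists2 V, valuation_overring V & contracted V v.

(** If [x] lies in [v V], then [x w] lies in [v w V], hence in [v w D]. *)
Lemma contracted_divisor V v w : contracted V (v * w) -> contracted V v.
Proof.
move=> [vw0 cvw]; move: (vw0); rewrite mulf_eq0 negb_or => /andP [v0 w0].
split=> // x Vx; apply: (divides_factor w0); rewrite mulrC [w * x]mulrC.
apply: cvw; rewrite !tofracM -mulf_div divff ?mulr1 //.
by rewrite tofrac_eq0.
Qed.

Definition in_radical v x : Prop := exists n, divides v (x ^+ n).

(** Of two factors, the one with the larger value in [V] has a square of value
    at least that of the product, so that its square lies in [v V `&` D]. *)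
Lemma in_radical_prime V v x y : valuation_overring V -> contracted V v ->
  in_radical v (x * y) -> in_radical v x \/ in_radical v y.
Proof.
move=> valV [v0 cv] [n]; rewrite exprMn.
have key a b : a != 0 -> b != 0 -> divides v (a * b) ->
    V (tofrac a / tofrac b) -> divides v (a ^+ 2).
  move=> a0 b0 dvab Vab; apply: cv.
  have -> : tofrac (a ^+ 2) / tofrac v =
            tofrac a / tofrac b * (tofrac (a * b) / tofrac v).
    by rewrite tofracXn tofracM; apply: square_split; rewrite tofrac_eq0.
  apply: valuation_overringM => //.
  by case: dvab => c ->; rewrite tofracM mulrAC divff ?mul1r
    ?tofrac_eq0 //; exact: valuation_overring_incl.
have [->|x0] := eqVneq x 0.
  by left; exists 1; exists 0; rewrite expr1 mulr0.
have [->|y0] := eqVneq y 0.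
  by right; exists 1; exists 0; rewrite expr1 mulr0.
have [xn0 yn0] : x ^+ n != 0 /\ y ^+ n != 0 by rewrite !expf_neq0.
move=> dv; have [|Vxy|Vyx] := proj2 valV (tofrac (x ^+ n) / tofrac (y ^+ n)).
- by rewrite mulf_neq0 ?invr_eq0 ?tofrac_eq0.
- by left; exists (n * 2)%N; rewrite exprM; exact: key dv Vxy.
right; exists (n * 2)%N; rewrite exprM; apply: key (xn0) _ _ => //.
  by rewrite mulrC.
by move: Vyx; rewrite invf_div.
Qed.

Lemma in_radical_prod V v s : valuation_overring V -> contracted V v ->
  divides v (\prod_(x <- s) x) ->
  divides v 1 \/ exists2 x, x \in s & in_radical v x.
Proof.
move=> valV cv dv; have {dv} : in_radical v (\prod_(x <- s) x) by exists 1%N.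
elim: s => [|x s IHs].
  by rewrite big_nil => -[n]; rewrite expr1n; left.
rewrite big_cons => /(in_radical_prime valV cv) [rx|/IHs [|[y sy ry]]].
- by right; exists x; rewrite ?mem_head.
- by left.
- by right; exists y; rewrite // in_cons sy orbT.
Qed.

(** If [w] lies in [v V], then [v] divides [w].  Otherwise [v / w] lies in [V],
    and [v ^+ n.+2 = w c] gives [c = v ^+ n.+1 * (v / w)] in [v V `&` D]: one
    factor [v] cancels and [w] divides [v ^+ n.+1]. *)
Lemma divides_power_comparable V v w n : valuation_overring V ->
  contracted V v -> w != 0 -> divides w (v ^+ n) ->
  divides v w \/ divides w v.
Proof.
move=> valV [v0 cv] w0 dw.
have [|Vwv|] := proj2 valV (tofrac w / tofrac v).
- by rewrite mulf_neq0 ?invr_eq0 ?tofrac_eq0.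
- by left; apply: cv.
rewrite invf_div => Vvw; right.
elim: n dw => [|[|n] IHn]; [rewrite expr0 => dw|by rewrite expr1|move=> [c Ec]].
  by rewrite -[v]mul1r; exact: divides_mull.
have [e Ee] : divides v c.
  have Ecv : tofrac w * tofrac c = tofrac v ^+ n.+2.
    by rewrite -tofracM -Ec tofracXn.
  apply: cv.
  have -> : tofrac c / tofrac v = tofrac (v ^+ n) * (tofrac v / tofrac w).
    by rewrite (power_split _ _ _ _ _ _ _ Ecv) ?tofrac_eq0 // tofracXn.
  apply: valuation_overringM => //; exact: valuation_overring_incl.
apply: IHn; exists e; apply: (mulfI v0).
by rewrite -exprS Ec Ee mulrCA.
Qed.

(** As the radical of [v] is prime, some power of one of the factors is
    divisible by [v]; that factor is then comparable to [v].  Either it absorbs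
    [v], or it can be cancelled on both sides. *)
Lemma contracted_primal_prod V v s t : valuation_overring V ->
  contracted V v -> {in s ++ t, forall x, contracted_valuation x} ->
  divides v ((\prod_(x <- s) x) * \prod_(x <- t) x) ->
  exists v1 v2, [/\ v = v1 * v2, divides v1 (\prod_(x <- s) x)
                  & divides v2 (\prod_(x <- t) x)].
Proof.
move=> valV; have [n] := ubnP (size s + size t).
elim: n s t v => // n IHn s t v lts cv cvst dv.
move: (dv); rewrite -big_cat => /(in_radical_prod valV cv) [d1|[x]].
  exists v, 1; split; [by rewrite mulr1| |exact: divides1l].
  exact: divides_trans d1 (divides1l _).
rewrite mem_cat; wlog sx : s t lts cvst dv / x \in s => [hw|_ rx].
  case/orP=> [sx|tx]; first by apply: (hw s t) => //; rewrite sx.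
  case/(hw t s) => //; [by rewrite addnC| |by rewrite mulrC|by rewrite tx|].
    by move=> y yts; apply: cvst; rewrite mem_cat orbC -mem_cat.
  by move=> v1 [v2 [-> d1 d2]]; exists v2, v1; rewrite mulrC.
have [W valW cx] : contracted_valuation x by apply: cvst; rewrite mem_cat sx.
case: rx => m /(divides_power_comparable valW cx (proj1 cv)) [[v' Ev]|dvx].
  rewrite (big_rem x) //= -mulrA Ev in dv.
  have cv' : contracted V v'.
    by apply: (@contracted_divisor _ _ x); rewrite mulrC -Ev.
  have [||v1 [v2 [Ev' d1 d2]]] := IHn (rem x s) t v' _ cv' _
      (divides_factor (proj1 cx) dv).
  - by move: lts; rewrite size_rem //; case: (s) sx.
  - move=> y; rewrite mem_cat => yst; apply: cvst; rewrite mem_cat.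
    by case/orP: yst => [/mem_rem -> //|->]; rewrite orbT.
  exists (x * v1), v2; split=> //; first by rewrite Ev Ev' mulrA.
  by rewrite (big_rem x) //=; case: d1 => c ->; exists c; rewrite mulrA.
exists v, 1; split; [by rewrite mulr1| |exact: divides1l].
exact: divides_trans dvx (divides_mem sx).
Qed.

Definition contracted_product a : Prop :=
  exists2 s, {in s, forall x, contracted_valuation x} & a = \prod_(x <- s) x.

Lemma contracted_primal V v a b : valuation_overring V -> contracted V v ->
  (forall x, x != 0 -> contracted_product x) -> divides v (a * b) ->
  exists v1 v2, [/\ v = v1 * v2, divides v1 a & divides v2 b].
Proof.
move=> valV cv prodD dv.
have [->|/prodD [s cs Ea]] := eqVneq a 0.
  by exists v, 1; split; [rewrite mulr1|exists 0; rewrite mulr0|exact: divides1l].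
have [->|/prodD [t ct Eb]] := eqVneq b 0.
  by exists 1, v; split; [rewrite mul1r|exact: divides1l|exists 0; rewrite mulr0].
rewrite Ea Eb in dv *; apply: (contracted_primal_prod valV cv _ dv).
by move=> x; rewrite mem_cat => /orP [/cs|/ct].
Qed.

Lemma min_value V s : valuation_overring V ->
  exists2 m, m = 0 \/ m \in s &
    {in s, forall a, exists2 q, V q & tofrac a = tofrac m * q}.
Proof.
move=> valV; have V0 : V 0 by rewrite -tofrac0; exact: valuation_overring_incl.
have V1 := valuation_overring1 valV.
(* The empty family is given the minimum 0. *)
elim: s => [|x s [m ms Hm]]; first by exists 0; [left|].
have [x0|x0] := eqVneq x 0.
  exists m; first by case: ms => [|sm]; [left|right; rewrite in_cons sm orbT].
  move=> a; rewrite in_cons => /predU1P [->|/Hm //].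
  by exists 0; rewrite // mulr0 x0 tofrac0.
have [m0|m0] := eqVneq m 0.
  exists x; first by right; exact: mem_head.
  move=> a; rewrite in_cons => /predU1P [->|/Hm [q _ ->]].
    by exists 1; rewrite ?mulr1.
  by exists 0; rewrite // m0 tofrac0 mul0r mulr0.
have [|Vxm|] := proj2 valV (tofrac x / tofrac m).
- by rewrite mulf_neq0 ?invr_eq0 ?tofrac_eq0.
- exists m; first by case: ms => [|sm]; [left|right; rewrite in_cons sm orbT].
  move=> a; rewrite in_cons => /predU1P [->|/Hm //].
  by exists (tofrac x / tofrac m); rewrite // mulrC mulfVK // tofrac_eq0.
rewrite invf_div => Vmx; exists x; first by right; exact: mem_head.
move=> a; rewrite in_cons => /predU1P [->|/Hm [q Vq ->]].
  by exists 1; rewrite ?mulr1.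
exists (tofrac m / tofrac x * q); first exact: valuation_overringM.
by rewrite mulrA mulrCA divff ?tofrac_eq0 // mulr1.
Qed.

(** Primality extends to finite families: split [v] along the members of
    minimal value, and observe that a divisor of [v] is again contracted from
    [V], so that it divides everything of larger value. *)
Lemma contracted_primal_families V v s t :
  valuation_overring V -> contracted V v ->
  (forall x, x != 0 -> contracted_product x) ->
  {in s & t, forall a b, divides v (a * b)} ->
  exists v1 v2, [/\ v = v1 * v2, {in s, forall a, divides v1 a}
                  & {in t, forall b, divides v2 b}].
Proof.
move=> valV cv prodD dv.
have [a sa mina] := min_value s valV; have [b tb minb] := min_value t valV.
have dab : divides v (a * b).
  case: sa => [->|sa]; first by exists 0; rewrite mul0r mulr0.
  by case: tb => [->|tb]; [exists 0; rewrite !mulr0|exact: dv].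
have [v1 [v2 [Ev d1 d2]]] := contracted_primal valV cv prodD dab.
have extend u m r : contracted V u -> divides u m ->
    {in r, forall x, exists2 q, V q & tofrac x = tofrac m * q} ->
    {in r, forall x, divides u x}.
  move=> [u0 cu] [c Em] minm x /minm [q Vq Ex]; apply: cu.
  rewrite Ex Em tofracM -[tofrac u * _ * _]mulrA mulrAC divff ?tofrac_eq0 // mul1r.
  by apply: valuation_overringM => //; exact: valuation_overring_incl.
exists v1, v2; split=> //.
  by apply: extend d1 mina; apply: (@contracted_divisor _ _ v2); rewrite -Ev.
by apply: extend d2 minb; apply: (@contracted_divisor _ _ v1); rewrite mulrC -Ev.
Qed.

Lemma divides_all a s : {in s, forall x, divides a x} ->
  exists t, s = [seq a * x | x <- t].
Proof.
elim: s => [|x s IHs] ds; first by exists [::].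
have [c Ec] := ds x (mem_head _ _).
have [y sy|t ->] := IHs; first by apply: ds; rewrite in_cons sy orbT.
by exists (c :: t); rewrite Ec.
Qed.

(** The contracted factors of [d] are split one at a time, the quotients of the
    two families by the parts already split off serving as new families. *)
Lemma product_primal_families d s t :
  (forall x, x != 0 -> contracted_product x) -> d != 0 ->
  {in s & t, forall a b, divides d (a * b)} ->
  exists d1 d2, [/\ d = d1 * d2, {in s, forall a, divides d1 a}
                  & {in t, forall b, divides d2 b}].
Proof.
move=> prodD /prodD [r cr ->].
elim: r cr s t => [|v r IHr] cr s t dst.
  by exists 1, 1; rewrite big_nil mulr1; split=> // ? _; exact: divides1l.
have [V valV cv] := cr v (mem_head _ _); have v0 := proj1 cv.
have dv : {in s & t, forall a b, divides v (a * b)}.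
  move=> a b sa tb; apply: divides_trans (dst a b sa tb).
  by rewrite big_cons; exact/divides_mull/divides_refl.
have [v1 [v2 [Ev d1 d2]]] := contracted_primal_families valV cv prodD dv.
have [s' Es] := divides_all d1; have [t' Et] := divides_all d2.
have [x rx|a b sa tb|e1 [e2 [Er De1 De2]]] := IHr _ s' t'.
- by apply: cr; rewrite in_cons rx orbT.
- apply: (divides_factor v0).
  have -> : v * (a * b) = (v1 * a) * (v2 * b) by rewrite Ev mulrACA.
  have /= := dst (v1 * a) (v2 * b); rewrite big_cons; apply.
    by rewrite Es; exact: map_f.
  by rewrite Et; exact: map_f.
exists (v1 * e1), (v2 * e2); split; first by rewrite big_cons Er Ev mulrACA.
  rewrite Es => _ /mapP [x sx ->]; have [c ->] := De1 _ sx.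
  by exists c; rewrite mulrA.
rewrite Et => _ /mapP [x tx ->]; have [c ->] := De2 _ tx.
by exists c; rewrite mulrA.
Qed.

End Divisibility.

(** * Submodules of the quotient field *)

Section Ideals.
Set Implicit Arguments.
Unset Strict Implicit.
Unset Printing Implicit Defensive.
Import GRing.Theory.
Local Open Scope ring_scope.
Local Open Scope classical_set_scope.
Variable D : idomainType.
Implicit Types (a b c v w x y : D) (s t : seq D) (V : set {fraction D}).
Implicit Types (A B C I J N : set {fraction D}) (star : star_operation D).

Local Notation ringD := (@ring_image D).

Lemma ring_image_submodule : is_submodule ringD.
Proof.
split=> [|_ _ [x _ <-] [y _ <-]|d _ [x _ <-]].
- by exists 0; rewrite ?tofrac0.
- by exists (x + y); rewrite ?tofracD.
- by exists (d * x); rewrite ?tofracM.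
Qed.

Lemma ring_image1 : ringD 1.
Proof. by exists 1; rewrite ?tofrac1. Qed.

Lemma submoduleM A (r x : {fraction D}) :
  is_submodule A -> ring_image r -> A x -> A (r * x).
Proof. by move=> [_ _ AM] [d _ <-]; exact: AM. Qed.

Lemma submodule_sum A n (a : 'I_n -> {fraction D}) :
  is_submodule A -> (forall i, A (a i)) -> A (\sum_(i < n) a i).
Proof. by move=> [A0 AD _] Aa; apply: big_ind. Qed.

Lemma submodule_preimage A (c : {fraction D}) :
  is_submodule A -> is_submodule [set x | A (c * x)].
Proof.
move=> [A0 AD AM]; split=> /= [|x y Ax Ay|d x Ax].
- by rewrite mulr0.
- by rewrite mulrDr; exact: AD.
- by rewrite mulrCA; exact: AM.
Qed.

Lemma scale_setP A (c x : {fraction D}) : c != 0 ->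
  scale_set c A x <-> A (c^-1 * x).
Proof.
move=> c0; split=> [[y Ay <-]|Ax]; first by rewrite mulKf.
by exists (c^-1 * x); rewrite // mulVKf.
Qed.

Lemma scale_setE A (c : {fraction D}) : c != 0 ->
  scale_set c A = [set x | A (c^-1 * x)].
Proof. by move=> c0; apply/seteqP; split=> x /scale_setP; apply. Qed.

Lemma principalP (c x : {fraction D}) : c != 0 ->
  principal c x <-> ring_image (c^-1 * x).
Proof. exact: scale_setP. Qed.

Lemma principal_gen (c : {fraction D}) : principal c c.
Proof. by exists 1; rewrite ?mulr1 //; exact: ring_image1. Qed.

Lemma fractionP (x : {fraction D}) :
  exists2 d : D, d != 0 & ring_image (tofrac d * x).
Proof.
elim/generic_quotient.quotW: x => r; have d0 := denom_ratioP r.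
exists (frac r).2 => //; exists (frac r).1 => //; apply/esym; unlock tofrac.
rewrite -[LHS]FracField.pi_mul; apply/generic_quotient.eqmodP.
by rewrite /= FracField.equivfE /FracField.mulf /= !numden_Ratio ?oner_eq0
  ?mul1r ?mulr1 // mulrC.
Qed.

Lemma common_denominator (s : seq {fraction D}) :
  exists d t, d != 0 /\ s = [seq tofrac x / tofrac d | x <- t].
Proof.
elim: s => [|x s [d [t [d0 ->]]]]; first by exists 1, [::]; rewrite oner_neq0.
have [e e0 [n _ En]] := fractionP x.
exists (d * e), (n * d :: [seq e * y | y <- t]).
split; first by rewrite mulf_neq0.
have [Fd Fe] : tofrac d != 0 /\ tofrac e != 0 by rewrite !tofrac_eq0.
rewrite /= -map_comp; congr (_ :: _).
  rewrite !tofracM En [_ * tofrac d]mulrC mulrA mulrAC divff ?mul1r //.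
  by rewrite mulf_neq0.
apply: eq_map => y /=; rewrite !tofracM [tofrac d * _]mulrC -mulf_div.
by rewrite divff ?mul1r.
Qed.

Lemma frac_ideal_ring : frac_ideal ringD.
Proof.
split; first exact: ring_image_submodule.
  exists 1; first exact: oner_neq0.
  by move=> _ [x Rx <-]; rewrite tofrac1 mul1r.
by exists 1; [exact: oner_neq0|exact: ring_image1].
Qed.

Lemma frac_ideal_scale (c : {fraction D}) A : c != 0 ->
  frac_ideal A -> frac_ideal (scale_set c A).
Proof.
move=> c0 [sA [d d0 dA] [x x0 Ax]]; split.
- by rewrite scale_setE //; exact: submodule_preimage.
- have [e e0 Re] := fractionP c; exists (e * d); first by rewrite mulf_neq0.
  move=> _ [_ [y Ay <-] <-]; rewrite tofracM mulrACA.
  by apply: submoduleM Re _; [exact: ring_image_submodule|apply: dA; exists y].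
- by exists (c * x); [rewrite mulf_neq0|exists x].
Qed.

Lemma frac_ideal_principal (c : {fraction D}) : c != 0 ->
  frac_ideal (principal c).
Proof. by move=> c0; apply: frac_ideal_scale => //; exact: frac_ideal_ring. Qed.

Lemma frac_ideal_inv A : frac_ideal A -> frac_ideal (inv_set A).
Proof.
have [R0 RD RM] := ring_image_submodule.
move=> [sA [d d0 dA] [x x0 Ax]]; split.
- split=> [_ [y _ <-]|y z Iy Iz _ [w Aw <-]|e y Iy _ [w Aw <-]].
  + by rewrite mul0r.
  + by rewrite mulrDl; apply: RD; [apply: Iy|apply: Iz]; exists w.
  + by rewrite -mulrA; apply: RM; apply: Iy; exists w.
- have [e e0 [n _ En]] := fractionP x; exists n.
    by rewrite -tofrac_eq0 En mulf_neq0 ?tofrac_eq0.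
  move=> _ [y Iy <-]; rewrite En -mulrA [x * y]mulrC.
  by apply: RM; apply: Iy; exists x.
- by exists (tofrac d); rewrite ?tofrac_eq0.
Qed.

Lemma prod_set_mul A B (a b : {fraction D}) : A a -> B b -> prod_set A B (a * b).
Proof.
by move=> Aa Bb; exists 1%N, (fun=> a), (fun=> b); rewrite big_ord1.
Qed.

Lemma prod_set_min A B N : is_submodule N ->
  (forall a b : {fraction D}, A a -> B b -> N (a * b)) -> prod_set A B `<=` N.
Proof.
move=> sN AB _ [n [a [b [Aa Bb ->]]]]; apply: submodule_sum => // i; exact: AB.
Qed.

Lemma prod_set_submodule A B : is_submodule A -> is_submodule (prod_set A B).
Proof.
move=> [A0 AD AM]; split.
- exists 0%N, (fun=> 0), (fun=> 0); rewrite big_ord0.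
  by split=> // -[].
- move=> _ _ [n [a [b [Aa Bb ->]]]] [m [c [e [Ac Be ->]]]].
  exists (n + m)%N, (fun i => match split i with inl j => a j | inr j => c j end),
    (fun i => match split i with inl j => b j | inr j => e j end).
  split=> [i|i|]; try by case: split.
  rewrite big_split_ord /=; congr (_ + _); apply: eq_bigr => i _.
    by rewrite (unsplitK (inl i)).
  by rewrite (unsplitK (inr i)).
- move=> d _ [n [a [b [Aa Bb ->]]]]; exists n, (fun i => tofrac d * a i), b.
  split=> // [i|]; first exact: AM.
  by rewrite mulr_sumr; apply: eq_bigr => i _; rewrite mulrA.
Qed.

Lemma prod_set_principal (c : {fraction D}) B : c != 0 -> is_submodule B ->
  prod_set (principal c) B = scale_set c B.
Proof.
move=> c0 sB; apply/seteqP; split; last first.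
  by move=> _ [x Bx <-]; apply: prod_set_mul => //; exact: principal_gen.
rewrite scale_setE //; apply: prod_set_min; first exact: submodule_preimage.
by move=> a b /principalP - /(_ c0) Ra Bb /=; rewrite mulrA; exact: submoduleM.
Qed.

Lemma frac_ideal_prod A B : frac_ideal A -> frac_ideal B ->
  frac_ideal (prod_set A B).
Proof.
move=> [sA [d d0 dA] [x x0 Ax]] [sB [e e0 eB] [y y0 By]]; split.
- exact: prod_set_submodule.
- exists (d * e) => [|_ [z ABz <-]]; first by rewrite mulf_neq0.
  move: z ABz; apply: (prod_set_min (submodule_preimage _ ring_image_submodule)).
  move=> a b Aa Bb /=; rewrite tofracM mulrACA.
  apply: (submoduleM ring_image_submodule); first by apply: dA; exists a.
  by apply: eB; exists b.
- by exists (x * y); [rewrite mulf_neq0|exact: prod_set_mul].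
Qed.

Lemma ideal_prod A B : is_ideal A -> is_ideal B -> is_ideal (prod_set A B).
Proof.
move=> [sA RA] [sB RB]; split; first exact: prod_set_submodule.
apply: prod_set_min ring_image_submodule _ => a b /RA Ra /RB.
exact: submoduleM ring_image_submodule Ra.
Qed.

Lemma ideal_bigprod n (J : 'I_n -> set {fraction D}) :
  (forall i, is_ideal (J i)) -> is_ideal (\big[@prod_set D/ringD]_(i < n) J i).
Proof.
move=> iJ; apply: big_ind => //; last exact: ideal_prod.
by split=> //; exact: ring_image_submodule.
Qed.

(** An ideal is fractional as soon as it is nonzero, and a product with a zero
    factor vanishes. *)
Lemma frac_ideal_factors A B : is_ideal A -> is_ideal B ->
  frac_ideal (prod_set A B) -> frac_ideal A /\ frac_ideal B.
Proof.
have zero_sub : is_submodule [set x : {fraction D} | x = 0].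
  split=> //= [_ _ -> ->|d _ ->]; [exact: addr0|exact: mulr0].
have frac I : is_ideal I ->
    ~ (forall x : {fraction D}, I x -> x = 0) -> frac_ideal I.
  move=> [sI RI] nI; split=> //.
    exists 1 => [|_ [x /RI Rx <-]]; first exact: oner_neq0.
    by rewrite tofrac1 mul1r.
  apply: contrapT => nx; apply: nI => x Ix; apply/eqP/negP => /negP x0.
  by apply: nx; exists x.
move=> iA iB [_ _ [x x0 ABx]]; split; apply: frac => // z0.
  suff E : x = 0 by rewrite E eqxx in x0.
  by apply: (prod_set_min zero_sub _ ABx) => a b /z0 -> _; exact: mul0r.
suff E : x = 0 by rewrite E eqxx in x0.
by apply: (prod_set_min zero_sub _ ABx) => a b _ /z0 ->; exact: mulr0.
Qed.

(** * Valuation elements as contracted elements *)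

Lemma valuation_ideal_principal a : a != 0 ->
  valuation_ideal (principal (tofrac a)) <-> contracted_valuation a.
Proof.
move=> a0; have Fa0 : tofrac a != 0 by rewrite tofrac_eq0.
have prodV V : valuation_overring V ->
    prod_set (principal (tofrac a)) V = scale_set (tofrac a) V.
  move=> valV; apply: prod_set_principal => //; split=> [|x y Vx Vy|d x Vx].
  - by rewrite -tofrac0; exact: valuation_overring_incl.
  - exact: valuation_overringD.
  - by apply: valuation_overringM => //; exact: valuation_overring_incl.
split=> [[_ [V valV]]|[V valV [_ cV]]].
  rewrite prodV // => EV; exists V => //; split=> // x Vx; apply/dividesP => //.
  rewrite mulrC; apply/principalP => //; rewrite -EV; split; last by exists x.
  by apply/scale_setP; rewrite // mulrC.
split.
  split; first by have [] := frac_ideal_principal Fa0.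
  by move=> _ [_ [d _ <-] <-]; exists (a * d); rewrite ?tofracM.
exists V => //; rewrite prodV //; apply/seteqP; split.
  move=> y [/scale_setP - /(_ Fa0) Vy [x _ E]]; rewrite -{}E mulrC in Vy *.
  by apply/principalP; rewrite // mulrC; apply/dividesP => //; exact: cV.
move=> _ [_ [d _ <-] <-]; split; last by exists (a * d); rewrite ?tofracM.
by exists (tofrac d); rewrite //; exact: valuation_overring_incl.
Qed.

Lemma unit_contracted_valuation (u : D) : u \is a GRing.unit ->
  contracted_valuation u.
Proof.
move=> Uu; exists setT.
  split=> [|x _]; last by left.
  by split=> //; split=> [|x y _ _|x y _ _]; exact: in_setT.
split=> [|x _]; last by exists (u^-1 * x); rewrite mulrA divrr ?mul1r.
by apply: contraTneq Uu => ->; rewrite unitr0.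
Qed.

Lemma contracted_valuation_unitM (u v : D) : u \is a GRing.unit ->
  contracted_valuation v -> contracted_valuation (u * v).
Proof.
move=> Uu [V valV [v0 cv]]; have u0 : u != 0.
  by apply: contraTneq Uu => ->; rewrite unitr0.
exists V => //; split=> [|x Vx]; first by rewrite mulf_neq0.
have [|c ->] := cv x.
  have -> : tofrac x / tofrac v = tofrac u * (tofrac x / tofrac (u * v)).
    by rewrite tofracM invfM mulrCA [tofrac u * _]mulrA divff ?mul1r ?tofrac_eq0.
  by apply: valuation_overringM => //; exact: valuation_overring_incl.
by exists (u^-1 * c); rewrite mulrACA divrr ?mul1r.
Qed.

(** Unit factors make no difference: in a factorization of a nonunit they can
    be absorbed into some nonunit factor, and a unit is its own factorization. *)
Lemma contracted_product_VFD :
  (forall x, x != 0 -> contracted_product x) <-> VFD D.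
Proof.
split=> [prodD x x0 Ux|vfd x x0]; last first.
  have [Ux|Ux] := boolP (x \is a GRing.unit).
    exists [:: x]; last by rewrite big_seq1.
    by move=> y; rewrite inE => /eqP ->; exact: unit_contracted_valuation.
  have [n [a [va ->]]] := vfd x x0 Ux; exists (codom a).
    by move=> _ /codomP [i ->]; have [a0 _ /valuation_ideal_principal] := va i; apply.
  by rewrite big_map big_enum.
have [s cs Ex] := prodD x x0.
suff [y [t [vt ->]]] : exists y t, {in y :: t, forall z, valuation_element z}
    /\ x = \prod_(z <- y :: t) z.
  exists (size t), (fun i => nth y (y :: t) i); split=> [i|].
    by apply: vt; rewrite mem_nth //=.
  by rewrite (big_nth y) big_mkord.
have val (z : D) : z \isn't a GRing.unit -> contracted_valuation z ->
    valuation_element z.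
  move=> Uz cz; have z0 : z != 0 by case: cz => V _ [].
  by split=> //; apply/(valuation_ideal_principal z0).
rewrite {}Ex in Ux *; clear x x0.
elim: s cs Ux => [|x s IHs] cs; first by rewrite big_nil unitr1.
have cx := cs x (mem_head _ _).
have {}cs : {in s, forall z, contracted_valuation z}.
  by move=> z sz; apply: cs; rewrite in_cons sz orbT.
rewrite big_cons; have [Us|Us] := boolP (\prod_(z <- s) z \is a GRing.unit).
  rewrite unitrM Us andbT => Ux; rewrite mulrC; set u := \prod_(z <- s) z in Us *.
  exists (u * x), [::]; rewrite big_seq1; split=> // z; rewrite inE => /eqP ->.
  by apply: val; [rewrite unitrM Us|exact: contracted_valuation_unitM].
have [y [t [vt ->]]] := IHs cs Us => _.
have [Ux|Ux] := boolP (x \is a GRing.unit); last first.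
  exists x, (y :: t); split=> [z|]; last by rewrite [RHS]big_cons.
  by rewrite in_cons => /predU1P [->|/vt //]; exact: val.
exists (x * y), t; rewrite !big_cons mulrA; split=> // z.
rewrite in_cons => /predU1P [->|tz]; last by apply: vt; rewrite in_cons tz orbT.
have [y0 Uy /valuation_ideal_principal cy] := vt y (mem_head _ _).
apply: val; first by rewrite unitrM Ux.
by apply: contracted_valuation_unitM => //; exact: cy.
Qed.

(** * Star closures and principal ideals *)

Lemma bigprod_principal n (a : 'I_n -> D) : (forall i, a i != 0) ->
  \big[@prod_set D/ringD]_(i < n) principal (tofrac (a i)) =
  principal (tofrac (\prod_(i < n) a i)).
Proof.
elim: n a => [|n IHn] a a0.
  rewrite !big_ord0 tofrac1; apply/seteqP; split=> [x Rx|_ [x Rx <-]].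
    by exists x; rewrite ?mul1r.
  by rewrite mul1r.
rewrite !big_ord_recl IHn // prod_set_principal ?tofrac_eq0 //; last first.
  have /frac_ideal_principal [] // : tofrac (\prod_(i < n) a (lift ord0 i)) != 0.
  by rewrite tofrac_eq0; apply/prodf_neq0.
apply/seteqP; split=> [_ [_ [x Rx <-] <-]|_ [x Rx <-]].
  by exists x; rewrite // tofracM mulrA.
by rewrite tofracM -mulrA; eexists; last reflexivity; exists x.
Qed.

Lemma star_principal star (c : {fraction D}) : c != 0 ->
  star (principal c) = principal c.
Proof.
move=> c0; rewrite /principal [LHS]star_scale ?star_ring //.
exact: frac_ideal_ring.
Qed.

Lemma star_integral star A : frac_ideal A -> A `<=` ringD ->
  star A `<=` ringD.
Proof.
by move=> fA RA; rewrite -(star_ring star); exact: star_mono frac_ideal_ring RA.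
Qed.

(** Monotonicity and homogeneity of star operations in a single rule, which
    transports every inclusion between ideals below to their star closures. *)
Lemma star_mul_sub star (c : {fraction D}) A B : frac_ideal A -> frac_ideal B ->
  (forall x : {fraction D}, A x -> B (c * x)) ->
  forall x : {fraction D}, star A x -> star B (c * x).
Proof.
move=> fA fB cAB x sAx; have [->|c0] := eqVneq c 0.
  by rewrite mul0r; have [[]] := star_frac star fB.
have : star (scale_set c A) `<=` star B.
  apply: star_mono => //; first exact: frac_ideal_scale.
  by move=> _ [y Ay <-]; exact: cAB.
by apply; rewrite star_scale //; exists x.
Qed.

Lemma principal_star_T star (c : {fraction D}) : c != 0 ->
  star_T star (principal c).
Proof.
move=> c0; have fc := frac_ideal_principal c0.
split; split=> //; first exact: star_principal.
suff -> : prod_set (principal c) (inv_set (principal c)) = ringD.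
  exact: star_ring.
have [sI _ _] := frac_ideal_inv fc; rewrite prod_set_principal //.
have [R0 RD RM] := ring_image_submodule.
apply/seteqP; split=> [_ [x Ix <-]|_ [x _ <-]].
  by rewrite mulrC; apply: Ix; exists c => //; exact: principal_gen.
apply/scale_setP => // _ [_ [y Ry <-] <-].
by rewrite mulrACA mulVf // mul1r; apply: RM.
Qed.

(** The class of [I] contains [I] itself, so that it is the trivial class only
    when [I] is principal. *)
Lemma star_Cl_trivialP star : star_Cl_trivial star <->
  forall I, star_T star I ->
    exists2 c : {fraction D}, c != 0 & I = principal c.
Proof.
have class_ring : star_class star ringD = @principal_frac D.
  have E (c : {fraction D}) : c != 0 ->
      star (prod_set ringD (principal c)) = principal c.
    move=> c0; have [sc _ _] := frac_ideal_principal c0.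
    have -> : ringD = principal 1.
      by apply/seteqP; split=> [x Rx|_ [x Rx <-]]; [exists x|]; rewrite ?mul1r.
    rewrite prod_set_principal ?oner_neq0 // scale_setE ?oner_neq0 //.
    rewrite -[RHS](star_principal star) //; congr (star _).
    by apply/seteqP; split=> x /=; rewrite invr1 mul1r.
  apply/seteqP; split=> [_ [_ [c c0 <-] <-]|_ [c c0 <-]].
    by rewrite E //; exists c.
  by rewrite -E //; exists (principal c) => //; exists c.
split=> [Cl0 I TI|prinT].
  have : star_Cl star (star_class star I) by exists I.
  rewrite Cl0 class_ring => /= classI.
  have : principal_frac I.
    rewrite -classI; exists (principal 1).
      by exists 1 => //=; exact: oner_neq0.
    have [[[sI _ _] EI] _] := TI; rewrite -[RHS]EI; congr (star _).
    apply/seteqP; split.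
      apply: prod_set_min => // a _ Ia [x Rx <-].
      by rewrite mul1r mulrC; exact: submoduleM.
    by move=> x Ix; rewrite -[x]mulr1; apply: prod_set_mul (principal_gen 1).
  by case=> c c0 <-; exists c.
have class_prin (c : {fraction D}) : c != 0 ->
    star_class star (principal c) = @principal_frac D.
  move=> c0; have E (b : {fraction D}) : b != 0 ->
      star (prod_set (principal c) (principal b)) = principal (c * b).
    move=> b0; have [sb _ _] := frac_ideal_principal b0.
    rewrite prod_set_principal // star_scale ?star_principal //; last first.
      exact: frac_ideal_principal.
    by apply/seteqP; split=> [_ [_ [x Rx <-] <-]|_ [x Rx <-]];
      [exists x|exists (b * x); first exists x]; rewrite // mulrA.
  apply/seteqP; split=> [_ [_ [b b0 <-] <-]|_ [b b0 <-]].
    by rewrite E //; exists (c * b) => //=; rewrite mulf_neq0.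
  have cb0 : c^-1 * b != 0 by rewrite mulf_neq0 ?invr_eq0.
  exists (principal (c^-1 * b)); first by exists (c^-1 * b).
  by rewrite E // mulVKf.
apply/seteqP; split=> [_ [I TI <-]|_ ->] /=.
  by have [c c0 ->] := prinT I TI; rewrite class_prin.
exists ringD => //.
suff -> : ringD = principal 1 by apply: principal_star_T; exact: oner_neq0.
by apply/seteqP; split=> [x Rx|_ [x Rx <-]]; [exists x|]; rewrite ?mul1r.
Qed.

(** [c^-1 B] is contained in the inverse of [A_*], and [c^-1 A B] has star
    closure [D]; hence [A_*] is star-invertible. *)
Lemma star_factor_principal star A B (c : {fraction D}) :
  star_Cl_trivial star -> frac_ideal A -> frac_ideal B -> c != 0 ->
  star (prod_set A B) = principal c ->
  exists2 b : {fraction D}, b != 0 & star A = principal b.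
Proof.
move=> /star_Cl_trivialP Cl0 fA fB c0 EAB; apply: Cl0.
have fsA := star_frac star fA; have fI := frac_ideal_inv fsA.
have fAB := frac_ideal_prod fA fB; have fP := frac_ideal_prod fsA fI.
have sR := ring_image_submodule.
split; split=> //; first exact: star_idem.
apply/seteqP; split.
  apply: star_integral fP _; apply: prod_set_min => // a b Aa Ib.
  by rewrite mulrC; apply: Ib; exists a.
move=> r Rr; rewrite -[r](mulKf c0); apply: (star_mul_sub fAB) => //; last first.
  by rewrite EAB; exists r.
apply: prod_set_min; first by apply: submodule_preimage; case: fP.
move=> a b Aa Bb /=; rewrite mulrCA; apply: prod_set_mul; first exact: star_ext.
move=> _ [y sAy <-]; rewrite -(star_ring star).
apply: (star_mul_sub fA frac_ideal_ring) sAy => x Ax.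
rewrite -mulrA; apply/principalP => //; rewrite -EAB; apply: star_ext => //.
by rewrite mulrC; exact: prod_set_mul.
Qed.

Lemma star_cofactor star A B (b c : {fraction D}) :
  frac_ideal A -> frac_ideal B -> b != 0 -> c != 0 ->
  star A = principal b -> star (prod_set A B) = principal c ->
  star B = principal (b^-1 * c).
Proof.
move=> fA fB b0 c0 EA EAB; have fAB := frac_ideal_prod fA fB.
have bc0 : b^-1 * c != 0 by rewrite mulf_neq0 ?invr_eq0.
apply/seteqP; split=> y.
  move=> sBy; apply/principalP => //; rewrite invfM invrK -mulrA mulrCA.
  apply/principalP => //; rewrite -(star_principal star c0) -EAB.
  apply: (star_mul_sub fB (star_frac star fAB)) sBy => x Bx; rewrite mulrC.
  apply: (star_mul_sub fA fAB); last by rewrite EA; exact: principal_gen.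
  by move=> a Aa; rewrite mulrC; exact: prod_set_mul.
case=> r Rr <-; rewrite -mulrA; apply: (star_mul_sub fAB) => //; last first.
  by rewrite EAB; exists r.
have [sB _ _] := fB.
apply: prod_set_min; first exact: submodule_preimage.
move=> a x Aa Bx /=; rewrite mulrA; apply: submoduleM => //.
by apply/principalP => //; rewrite -EA; exact: star_ext.
Qed.

(** Let [J = J V `&` D] and [J_* = b D].  If [x / b] lies in [V], then
    [(x / b) J] lies in [J V `&` D = J]; passing to star closures, [(x / b) b]
    lies in [b D]. *)
Lemma contracted_of_star star J (b : D) : b != 0 -> valuation_ideal J ->
  frac_ideal J -> star J = principal (tofrac b) -> contracted_valuation b.
Proof.
move=> b0 [_ [V valV EJ]] fJ Eb; exists V => //; split=> // x Vx.
have Fb0 : tofrac b != 0 by rewrite tofrac_eq0.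
apply/dividesP => //; rewrite mulrC; apply/principalP => //.
rewrite -Eb -[tofrac x](mulfVK Fb0).
apply: (star_mul_sub fJ fJ); last by rewrite Eb; exact: principal_gen.
move=> y Jy; rewrite -EJ; split; first by rewrite mulrC; exact: prod_set_mul.
rewrite -mulrA; apply: submoduleM; [exact: ring_image_submodule|by exists x|].
by apply/principalP => //; rewrite -Eb; exact: star_ext.
Qed.

(** Each factor, and each partial product of factors, has principal star
    closure, so that the factors can be peeled off successively. *)
Lemma contracted_product_of_star star n (J : 'I_n -> set {fraction D}) (c : D) :
  star_Cl_trivial star -> c != 0 -> (forall i, valuation_ideal (J i)) ->
  frac_ideal (\big[@prod_set D/ringD]_(i < n) J i) ->
  star (\big[@prod_set D/ringD]_(i < n) J i) = principal (tofrac c) ->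
  contracted_product c.
Proof.
move=> Cl0; elim: n J c => [|n IHn] J c c0 vJ.
  rewrite big_ord0 star_ring => _ Ec; exists [:: c]; last by rewrite big_seq1.
  move=> _ /[!inE] /eqP ->; apply: unit_contracted_valuation.
  have : principal (tofrac c) 1 by rewrite -Ec; exact: ring_image1.
  move=> [_ [d _ <-] /eqP]; rewrite -tofracM -tofrac1 tofrac_eq mulrC => /eqP dc.
  by apply/unitrPr; exists d; rewrite mulrC.
rewrite big_ord_recl; set B := \big[_/_]_(i < n) _ => fAB EAB.
have iA : is_ideal (J ord0) by have [] := vJ ord0.
have iB : is_ideal B by apply: ideal_bigprod => i; have [] := vJ (lift ord0 i).
have [fA fB] := frac_ideal_factors iA iB fAB.
have Fc0 : tofrac c != 0 by rewrite tofrac_eq0.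
have [b b0 Eb] := star_factor_principal Cl0 fA fB Fc0 EAB.
have EB := star_cofactor fA fB b0 Fc0 Eb EAB.
have [d _ Ed] : ring_image b.
  by apply: (@star_integral star _ fA iA.2); rewrite Eb; exact: principal_gen.
have [e _ Ee] : ring_image (b^-1 * tofrac c).
  by apply: (@star_integral star _ fB iB.2); rewrite EB; exact: principal_gen.
have d0 : d != 0 by rewrite -tofrac_eq0 Ed.
have Ec : c = d * e.
  by apply/eqP; rewrite -tofrac_eq tofracM Ed Ee mulVKf.
have e0 : e != 0 by apply: contraNneq c0 => e0; rewrite Ec e0 mulr0.
have [s cs Es] : contracted_product e.
  by apply: (IHn (fun i => J (lift ord0 i)) e e0 _ fB) => //; rewrite Ee.
exists (d :: s); last by rewrite big_cons -Es.
move=> x; rewrite in_cons => /predU1P [->|/cs //].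
by apply: (@contracted_of_star star _ _ d0 (vJ ord0) fA); rewrite Ed.
Qed.

Lemma star_product_principal star (a : D) : a != 0 -> contracted_product a ->
  star_product_of_valuation_ideals star (principal (tofrac a)).
Proof.
move=> a0 [s cs Ea].
(* The extra factor 1 makes the list of factors nonempty. *)
have ct : {in 1 :: s, forall x, contracted_valuation x}.
  move=> x; rewrite in_cons => /predU1P [->|/cs //].
  exact: unit_contracted_valuation (unitr1 _).
have {}ct i : contracted_valuation (nth 1 (1 :: s) (i : 'I_(size s).+1)).
  by apply: ct; exact: mem_nth.
have t0 i : nth 1 (1 :: s) (i : 'I_(size s).+1) != 0 by have [V _ []] := ct i.
exists (size s), (fun i => principal (tofrac (nth 1 (1 :: s) i))).
have -> : a = \prod_(i < (size s).+1) nth 1 (1 :: s) i.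
  have -> : a = \prod_(x <- 1 :: s) x by rewrite big_cons mul1r.
  by rewrite (big_nth 1) big_mkord.
cbv zeta; rewrite bigprod_principal //.
have p0 : tofrac (\prod_(i < (size s).+1) nth 1 (1 :: s) i) != 0.
  by rewrite tofrac_eq0; apply/prodf_neq0.
split=> [i||]; last by rewrite star_principal.
  exact/(valuation_ideal_principal (t0 i)).
exact: frac_ideal_principal.
Qed.

(** The elements [g i] are finite sums of products, so that finitely many
    products [a * b] generate a submodule containing all of them.  Quantifying
    over the submodules [N] avoids writing these sums. *)
Lemma prod_set_finite A B n (g : 'I_n -> {fraction D}) :
  (forall i, prod_set A B (g i)) ->
  exists s t : seq {fraction D},
    [/\ {in s, forall a : {fraction D}, A a},
        {in t, forall b : {fraction D}, B b} &
    forall N, is_submodule N ->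
      {in s & t, forall a b : {fraction D}, N (a * b)} ->
      forall i, N (g i)].
Proof.
elim: n g => [|n IHn] g ABg.
  by exists [::], [::]; split=> // N _ _ [].
have [s [t [As Bt sp]]] := IHn _ (fun i => ABg (lift ord0 i)).
have [m [a [b [Aa Bb E0]]]] := ABg ord0.
exists (codom a ++ s), (codom b ++ t); split.
- by move=> x; rewrite mem_cat => /orP [/codomP [i ->]|/As].
- by move=> x; rewrite mem_cat => /orP [/codomP [i ->]|/Bt].
move=> N sN Nst i; have [j ->|->] := unliftP ord0 i.
  apply: sp => // x y sx ty.
  by apply: Nst; rewrite mem_cat ?sx ?ty orbT.
rewrite E0; apply: submodule_sum => // k.
by apply: Nst; rewrite mem_cat codom_f.
Qed.

(** With [1] in [C_*], [C] finitely generated inside [I I^-1], choose finitely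
    many [a_i] in [I] and [b_j] in [I^-1] whose products generate a module
    containing [C].  Clearing denominators, the integrality of all [a_i b_j]
    says that one element divides every product of numerators; primality splits
    it, which yields [c] with [a_i] in [c D] and [b_j] in [c^-1 D].  Then
    [I C] lies in [c D] and [c C] lies in [I]; now take star closures. *)
Lemma star_invertible_principal star I :
  (forall x, x != 0 -> contracted_product x) -> finite_type star ->
  star_T star I -> exists2 c : {fraction D}, c != 0 & I = principal c.
Proof.
move=> prodD ft [[fI EI] [_ EII]].
have fII := frac_ideal_prod fI (frac_ideal_inv fI).
have [C [[fC [n [g EC]]] CII] C1] : exists2 C,
    fg_frac_ideal C /\ C `<=` prod_set I (inv_set I) & star C 1.
  have := ring_image1; rewrite -EII ft // => -[C CP C1]; by exists C.
have [s [t [Is It gst]]] : exists s t : seq {fraction D},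
    [/\ {in s, forall a : {fraction D}, I a},
    {in t, forall b : {fraction D}, inv_set I b} & forall N, is_submodule N ->
      {in s & t, forall a b : {fraction D}, N (a * b)} -> C `<=` N].
  have [i|s [t [Is It gst]]] := @prod_set_finite I (inv_set I) n g.
    apply: CII; rewrite EC; exists (fun j => (j == i)%:R).
    rewrite (bigD1 i) //= eqxx tofrac1 mul1r big1 ?addr0 // => j /negbTE ->.
    by rewrite tofrac0 mul0r.
  exists s, t; split=> // N sN Nst; rewrite EC => _ [d ->].
  have Ng := gst N sN Nst; apply: submodule_sum => // i.
  by apply: submoduleM => //; exists (d i).
have sR := ring_image_submodule; have [sI _ _] := fI.
have [c c0 [cs ct]] : exists2 c : {fraction D}, c != 0 &
    {in s, forall a : {fraction D}, ring_image (c^-1 * a)} /\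
    {in t, forall b : {fraction D}, ring_image (c * b)}.
  have [d [s' [d0 Es]]] := common_denominator s.
  have [e [t' [e0 Et]]] := common_denominator t.
  have de0 : d * e != 0 by rewrite mulf_neq0.
  have [Fd0 Fe0] : tofrac d != 0 /\ tofrac e != 0 by rewrite !tofrac_eq0.
  have [|x [y [Exy dx dy]]] := @product_primal_families D (d * e) s' t' prodD de0.
    move=> a b sa tb; apply/dividesP => //.
    have -> : tofrac (a * b) / tofrac (d * e) =
              (tofrac b / tofrac e) * (tofrac a / tofrac d).
      by rewrite !tofracM -mulf_div mulrC.
    have tb' : tofrac b / tofrac e \in t.
      by rewrite Et; apply/mapP; exists b.
    apply: (It _ tb'); exists (tofrac a / tofrac d) => //; apply: Is.
    by rewrite Es; apply/mapP; exists a.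
  move: (de0); rewrite Exy mulf_eq0 negb_or => /andP [x0 y0].
  have [Fx0 Fy0] : tofrac x != 0 /\ tofrac y != 0 by rewrite !tofrac_eq0.
  exists (tofrac x / tofrac d); first by rewrite mulf_neq0 ?invr_eq0.
  split=> z; [rewrite Es|rewrite Et] => /mapP [w].
    move=> /dx [k ->] ->; exists k => //; rewrite invf_div tofracM mulf_div.
    by rewrite mulrA [tofrac x * tofrac d]mulrC mulrAC divff ?mul1r ?mulf_neq0.
  move=> /dy [k ->] ->; exists k => //; rewrite tofracM mulf_div mulrA.
  by rewrite -!tofracM -Exy tofracM mulrAC divff ?mul1r ?tofrac_eq0.
exists c => //; have fc := frac_ideal_principal c0; have [sc _ _] := fc.
apply/seteqP; split=> x => [Ix|[r Rr <-]].
  rewrite -[x]mulr1 -(star_principal star c0).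
  apply: (star_mul_sub fC fc) C1; apply: gst; first exact: submodule_preimage.
  move=> a b sa tb; apply/principalP => //=.
  have -> : c^-1 * (x * (a * b)) = (b * x) * (c^-1 * a).
    by rewrite [RHS]mulrCA; congr (_ * _); rewrite mulrCA mulrC [x * b]mulrC.
  by apply: (submoduleM sR _ (cs a sa)); apply: (It b tb); exists x.
rewrite mulrC; apply: submoduleM => //.
rewrite -[c]mulr1 -EI; apply: (star_mul_sub fC fI) C1.
apply: gst; first exact: submodule_preimage.
by move=> a b sa tb /=; rewrite mulrCA mulrC; apply: submoduleM => //; [apply: ct|apply: Is].
Qed.

(** * The equivalence *)

(** The identity is a star operation, of finite type because every element of
    [A] generates a principal ideal inside [A]; for the element [0], which
    generates no fractional ideal, any nonzero element of [A] serves. *)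
Lemma exists_finite_type_star : exists star : star_operation D, finite_type star.
Proof.
exists (@StarOperation D id (fun A fA => fA) (fun A _ => @subset_refl _ A)
  (fun A _ => erefl) (fun A B _ _ AB => AB)
  (fun (c : {fraction D}) A _ _ => erefl) erefl).
move=> A fA /=; apply/seteqP; split=> [x Ax|x [C [_ CA] /CA //]].
suff gen (y : {fraction D}) : y != 0 -> A y ->
    principal y `<=` A /\ fg_frac_ideal (principal y).
  have [x0|x0] := eqVneq x 0.
    have [_ _ [y y0 Ay]] := fA; have [yA fy] := gen y y0 Ay.
    by exists (principal y) => //; rewrite x0; have [[[]]] := fy.
  by have [xA fx] := gen x x0 Ax; exists (principal x) => //; exact: principal_gen.
move=> y0 Ay; have [sA _ _] := fA; split.
  by move=> _ [r Rr <-]; rewrite mulrC; exact: submoduleM.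
split; first exact: frac_ideal_principal.
exists 1%N, (fun=> y); apply/seteqP; split=> [_ [_ [d _ <-] <-]|_ [d ->]].
  by exists (fun=> d); rewrite big_ord1 mulrC.
by rewrite big_ord1 mulrC; exists (tofrac (d ord0)); first exists (d ord0).
Qed.

(** The star-invertible star-ideals are here exactly the principal ideals
    of nonzero elements of [D]. *)
Lemma VIFD_factorization star : star_Cl_trivial star ->
  star_VIFD star <-> star_invertible_factorization star.
Proof.
move=> /star_Cl_trivialP Cl0; split=> [vifd I [sI RI] iI|fact a a0].
  have [c c0 EI] := Cl0 I (conj sI iI); rewrite EI in RI *.
  have [a _ Ea] := RI c (principal_gen c).
  by rewrite -Ea; apply: vifd; rewrite -tofrac_eq0 Ea.
have Fa0 : tofrac a != 0 by rewrite tofrac_eq0.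
have [sa ia] := principal_star_T star Fa0; apply: fact => //; split=> //.
by move=> _ [_ [d _ <-] <-]; exists (a * d); rewrite ?tofracM.
Qed.

Lemma VFD_star_VIFD star : VFD D -> finite_type star ->
  star_Cl_trivial star /\ star_VIFD star.
Proof.
move=> /contracted_product_VFD allprod ft; split; last first.
  by move=> a a0; apply: star_product_principal => //; exact: allprod.
by apply/star_Cl_trivialP => I TI; exact: star_invertible_principal TI.
Qed.

Lemma star_VIFD_VFD star : star_Cl_trivial star -> star_VIFD star -> VFD D.
Proof.
move=> Cl0 vifd; apply/contracted_product_VFD => a a0.
have [n [J [vJ fJ EJ]]] := vifd a a0.
by apply: contracted_product_of_star Cl0 a0 vJ fJ _; rewrite -EJ.
Qed.

End Ideals.

Theorem corollary3p5 (D : idomainType) :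
  [<-> VFD D;
       forall star : star_operation D, finite_type star ->
         star_Cl_trivial star /\ star_invertible_factorization star;
       forall star : star_operation D, finite_type star ->
         star_VIFD star /\ star_Cl_trivial star;
       exists star : star_operation D,
         [/\ finite_type star, star_Cl_trivial star
           & star_invertible_factorization star];
       exists star : star_operation D,
         [/\ finite_type star, star_VIFD star & star_Cl_trivial star]].
Proof.
tfae=> [vfd star ft|fact star ft|all|[star [ft Cl0 fact]]|[star [_ vifd Cl0]]].
- have [Cl0 vifd] := VFD_star_VIFD vfd ft.
  by split=> //; apply/VIFD_factorization.
- by have [Cl0 /(VIFD_factorization Cl0)] := fact star ft; split.
- have [star ft] := exists_finite_type_star D; have [vifd Cl0] := all star ft.
  by exists star; split=> //; apply/VIFD_factorization.
- by exists star; split=> //; apply/VIFD_factorization.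
- exact: star_VIFD_VFD Cl0 vifd.
Qed.
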